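(* The relations $e^F\overleftarrow y=\overrightarrow ye^F$ recursively determine $e^F$. Precisely: suppose $(N_\Gamma)_{\Gamma\in SS(A)}$ and $(N'_\Gamma)_{\Gamma\in SS(A)}$ are two families of real numbers, each satisfying (stated for $N$): (i) $N_\emptyset=1$; (ii) $N_\Gamma=0$ whenever $\chi(\Gamma)$ is greater than twice the number of connected components of $\Gamma$; (iii) for every $y=(-a,-b)\in\mathbb Z^2$ with $a>0$ and $b<a$, $$\sum_{\Gamma\in SS(A)}\frac{N_\Gamma}{|\operatorname{Aut}\Gamma|}\,\Gamma\overleftarrow y=\sum_{\Gamma\in SS(A)}\frac{N_\Gamma}{|\operatorname{Aut}\Gamma|}\,\overrightarrow y\Gamma .$$ Then $N_\Gamma=N'_\Gamma$ for all $\Gamma\in SS(A)$.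
   Context: Let $A=\{(a,b)\in\mathbb Z^2: a>0,\ b\le a\}$. $SS(A)$ is the set of isomorphism classes of finite collections (repetition allowed, possibly empty) of vectors in $A$ together with an equivalence relation on the collection; the equivalence classes $\Gamma_1,\dots,\Gamma_k$ are called the connected components and we write $\Gamma=\coprod_i\Gamma_i=\{\Gamma_1,\dots,\Gamma_k\}$. $\operatorname{Aut}\Gamma$ is the group of permutations of the collection preserving the vectors and the equivalence relation. $\chi(\Gamma):=\sum_{(a,b)\in\Gamma}(1+2a+2b)$. In the paper $e^F=\sum_{\Gamma\in SS(A)}\frac{n_\Gamma}{|\operatorname{Aut}\Gamma|}\Gamma$ is the generating function of (possibly disconnected) relative Gromov--Witten invariants $n_\Gamma$ of certain toric surfaces, which are numbers with properties (i) and (ii). For $y=(-a,-b)$ with $a>0$, $b<a$, let $SS(A)_y\subset SS(A\cup\{y\})$ be the subset of those collections containing exactly one vector equal to $y$; the sums in (iii) are formal sums of elements of $SS(A)_y$. Write $(a,b)\wedge(c,d)=ad-bc$. For a finite collection $X=\{v_1,\dots,v_r\}$ of vectors with positive first coordinate, ordered so that $v_i\wedge v_j\le0$ if $i<j$, set $$n_{X\overleftarrow y}:=\prod_{i=1}^r\max\Big\{0,\ v_i\wedge\Big(y+\sum_{j=i+1}^rv_j\Big)\Big\},\qquad n_{\overrightarrow yX}:=\prod_{i=1}^r\max\Big\{0,\ \Big(y+\sum_{j=1}^{i-1}v_j\Big)\wedge v_i\Big\}.$$ For $\Gamma=\{\Gamma_1,\dots,\Gamma_k\}\in SS(A)$ and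 a sub-collection $X\subset\Gamma$ of its vectors, let $$\Gamma_{X,y}:=\Big(\{y,\,y+\textstyle\sum_{v\in X}v\}\cup\bigcup_{\Gamma_i\cap X\ne\emptyset}\Gamma_i\setminus X\Big)\coprod_{\Gamma_j\cap X=\emptyset}\Gamma_j,\qquad \Gamma'_{X,y}:=\Big(\{y\}\cup\bigcup_{\Gamma_i\cap X\ne\emptyset}\Gamma_i\setminus X\Big)\coprod_{\Gamma_j\cap X=\emptyset}\Gamma_j,$$ where the collection in large brackets is one connected component. Define $$\Gamma\overleftarrow y:=\sum_{X\subset\Gamma\,:\,\Gamma_{X,y}\in SS(A)_y}n_{X\overleftarrow y}\Gamma_{X,y}+\sum_{X\subset\Gamma\,:\,y+\sum_{v\in X}v=(-1,0)}n_{X\overleftarrow y}\Gamma'_{X,y},$$ $$\overrightarrow y\Gamma:=\sum_{X\subset\Gamma\,:\,\Gamma_{X,y}\in SS(A)_y}n_{\overrightarrow yX}\Gamma_{X,y}+\sum_{X\subset\Gamma\,:\,y+\sum_{v\in X}v=(0,-1)}n_{\overrightarrow yX}\Gamma'_{X,y}.$$ (Sums over sub-collections count repeated vectors as distinct elements. For each element of $SS(A)_y$ only finitely many $\Gamma$ contribute to its coefficient in (iii), so the formal sums are well defined.) *)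

(* Defs.v *)
From HB Require Import structures.
From mathcomp Require Import all_boot all_order all_algebra all_fingroup.
From mathcomp Require Import generic_quotient.
From mathcomp Require Import boolp classical_sets fsbigop reals.
Set Implicit Arguments.
Unset Strict Implicit.
Unset Printing Implicit Defensive.
Import Order.TTheory GRing.Theory Num.Theory.
Local Open Scope quotient_scope.
Local Open Scope ring_scope.

Definition vec := (int * int)%type.

Definition wedge (v w : vec) : int := v.1 * w.2 - v.2 * w.1.

Lemma wedgeC v w : wedge v w = - wedge w v.
Proof. by rewrite /wedge opprB [v.1 * _]mulrC [v.2 * _]mulrC. Qed.

(* On vectors with positive first coordinate, a total preorder: v comes before *)
(* w when the slope of v is at least that of w.                                *)
Definition slope_ge : rel vec := fun v w => wedge v w <= 0.

Lemma slope_ge_trans :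
  {in [pred v : vec | 0 < v.1] & &, transitive slope_ge}.
Proof.
move=> [u1 u2] [v1 v2] [w1 w2]; rewrite !inE /slope_ge /wedge /= => u0 v0 w0.
rewrite !subr_le0 => vu uw; rewrite -(ler_pM2l u0).
apply: (@le_trans _ _ (v1 * (u2 * w1))); first by rewrite mulrCA ler_pM2l.
by rewrite mulrA [leRHS]mulrA ler_pM2r // [leRHS]mulrC.
Qed.

Definition inA : pred vec := [pred v : vec | (0 < v.1) && (v.2 <= v.1)].

(* A finite collection of vectors, indexed by 'I_cnum so that repetitions are  *)
(* distinct elements, with an equivalence relation on the index set.           *)
(* The type of cconn is not written rel 'I_cnum because its universe would     *)
(* make the choiceType instance incompatible with ring, lra and zify.          *)
Record coll := Coll {
  cnum : nat;
  cvec : 'I_cnum -> vec;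
  cconn : 'I_cnum -> 'I_cnum -> bool;
  cconnP : [/\ reflexive cconn, symmetric cconn & transitive cconn] }.

HB.instance Definition _ := gen_eqMixin coll.
HB.instance Definition _ := gen_choiceMixin coll.

Definition coll_iso (G H : coll) : Prop :=
  exists f : 'I_(cnum G) -> 'I_(cnum H),
    [/\ bijective f,
        forall i, cvec (f i) = cvec i &
        forall i j, cconn (f i) (f j) = cconn i j].

Definition coll_isob : rel coll := fun G H => `[< coll_iso G H >].

Lemma coll_isob_refl : reflexive coll_isob.
Proof. by move=> G; apply/asboolP; exists id; split=> //; exists id. Qed.

Lemma coll_isob_sym : symmetric coll_isob.
Proof.
suff H G H : coll_isob G H -> coll_isob H G by move=> *; apply/idP/idP; apply: H.
move=> /asboolP [f [[g fK gK] fv fc]]; apply/asboolP; exists g; split.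
- by exists f.
- by move=> i; rewrite -{2}(gK i) fv.
- by move=> i j; rewrite -{2}(gK i) -{2}(gK j) fc.
Qed.

Lemma coll_isob_trans : transitive coll_isob.
Proof.
move=> H G K /asboolP [f [fb fv fc]] /asboolP [g [gb gv gc]].
apply/asboolP; exists (g \o f); split.
- exact: bij_comp.
- by move=> i; rewrite /= gv fv.
- by move=> i j; rewrite /= gc fc.
Qed.

Canonical coll_iso_equiv :=
  EquivRel coll_isob coll_isob_refl coll_isob_sym coll_isob_trans.

Definition SS := {eq_quot coll_isob}.
HB.instance Definition _ := Choice.on SS.
HB.instance Definition _ := EqQuotient.on SS.

Definition iso_class (G : coll) : SS := \pi_SS G.

Lemma iso_classP (G H : coll) : iso_class G = iso_class H <-> coll_iso G H.
Proof.
by split=> [/eqquotP/asboolP|GH] //; apply/eqquotP/asboolP.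
Qed.

(* The collection indexed by an arbitrary finite type, through its enumeration. *)
Section CollOn.
Variables (T : finType) (v : T -> vec) (e : rel T).
Hypothesis eP : [/\ reflexive e, symmetric e & transitive e].

Lemma coll_onP : let e' := [rel i j : 'I_#|T| | e (enum_val i) (enum_val j)] in
  [/\ reflexive e', symmetric e' & transitive e'].
Proof.
case: eP => er es et; split=> [i|i j|j i k]; [exact: er|exact: es|exact: et].
Qed.

Definition coll_on : coll := Coll (fun i => v (enum_val i)) coll_onP.
End CollOn.

Lemma empty_connP : let e := (fun _ _ => true) : rel 'I_0 in
  [/\ reflexive e, symmetric e & transitive e].
Proof. by []. Qed.

Definition empty_coll : coll := Coll (fun _ : 'I_0 => 0 : vec) empty_connP.

Section Collection.
Variable G : coll.
Implicit Type X : {set 'I_(cnum G)}.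

Definition components : {set {set 'I_(cnum G)}} :=
  equivalence_partition (@cconn G) [set: 'I_(cnum G)].

Definition chi : int :=
  \sum_(i < cnum G) (1 + 2 * (cvec i).1 + 2 * (cvec i).2).

Definition Aut_coll : {set 'S_(cnum G)} :=
  [set s : 'S_(cnum G) | [forall i, cvec (s i) == cvec i]
     && [forall i, forall j, cconn (s i) (s j) == cconn i j]].

Definition vsum X : vec := \sum_(i in X) cvec i.

(* glue X u deletes the elements of X, adds the vectors u as new elements, and *)
(* merges the new elements and what remains of the components meeting X into   *)
(* one component.                                                              *)
Section Glue.
Variables (X : {set 'I_(cnum G)}) (u : seq vec).

Definition meets (i : 'I_(cnum G)) : bool := [exists j in X, cconn i j].

Definition glue_pt : finType := ('I_(size u) + {i : 'I_(cnum G) | i \notin X})%type.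

Definition glue_vec (p : glue_pt) : vec :=
  match p with inl k => u`_k | inr i => cvec (val i) end.

Definition glue_merged (p : glue_pt) : bool :=
  match p with inl _ => true | inr i => meets (val i) end.

Definition glue_conn : rel glue_pt := fun p q =>
  (glue_merged p && glue_merged q) ||
  match p, q with inr i, inr j => cconn (val i) (val j) | _, _ => false end.

Lemma meets_conn i j : cconn i j -> meets i = meets j.
Proof.
have [_ es et] := cconnP G.
suff H a b : cconn a b -> meets a -> meets b.
  by move=> eij; apply/idP/idP; apply: H => //; rewrite es.
move=> eab /existsP [k /andP [kX eak]]; apply/existsP; exists k.
by rewrite kX (et a) // es.
Qed.

Lemma glue_connP :
  [/\ reflexive glue_conn, symmetric glue_conn & transitive glue_conn].
Proof.
have [er es et] := cconnP G; split.
- by case=> [k|i]; rewrite /glue_conn //= er orbT.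
- by case=> [k|i] [l|j]; rewrite /glue_conn /= ?andbT ?orbF // andbC es.
case=> [k|i] [l|j] [m|h]; rewrite /glue_conn /= ?andbT ?orbF //.
- by move=> -> ->.
- by move=> mi /orP [/andP [] //|/meets_conn <-].
- by move=> /orP [/andP [] //|/meets_conn ->].
- move=> /orP [/andP [mj mi]|eji] /orP [/andP [mi' mh]|eih].
  + by rewrite mj mh.
  + by rewrite mj -(meets_conn eih) mi.
  + by rewrite (meets_conn eji) mi' mh.
  + by rewrite (et _ _ _ eji eih) orbT.
Qed.

Definition glue : coll := coll_on glue_vec glue_connP.
End Glue.

Definition glue_y X (y : vec) : SS := iso_class (glue X [:: y; y + vsum X]).
Definition glue_y' X (y : vec) : SS := iso_class (glue X [:: y]).

(* The products below do not depend on the order between parallel vectors, nor *)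
(* therefore on the choice of an ordered list.                                 *)
Definition ordered_vecs X : seq vec := sort slope_ge [seq cvec i | i in X].

Lemma ordered_vecs_perm X : perm_eq (ordered_vecs X) [seq cvec i | i in X].
Proof. by rewrite perm_sort. Qed.

Lemma ordered_vecs_ordered X : (forall i, 0 < (@cvec G i).1) ->
  pairwise slope_ge (ordered_vecs X).
Proof.
move=> pos; have all_pos: all (fun v : vec => 0 < v.1) (ordered_vecs X).
  by rewrite all_sort; apply/allP=> _ /mapP [i _ ->].
rewrite -(sorted_pairwise_in slope_ge_trans all_pos).
apply: sort_sorted => v w; rewrite /slope_ge wedgeC oppr_le0.
by case: (lerP 0 (wedge w v)) => //= /ltW.
Qed.

Definition n_left X (y : vec) : int :=
  let v := ordered_vecs X in
  \prod_(0 <= i < size v)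
    Num.max 0 (wedge v`_i (y + \sum_(i.+1 <= j < size v) v`_j)).

Definition n_right (y : vec) X : int :=
  let v := ordered_vecs X in
  \prod_(0 <= i < size v)
    Num.max 0 (wedge (y + \sum_(0 <= j < i) v`_j) v`_i).
End Collection.

Definition SS_A : set SS :=
  [set Gam : SS | forall i, inA (@cvec (repr Gam) i)].

Definition SS_Ay (y : vec) : set SS :=
  [set Gam : SS | (forall i, inA (@cvec (repr Gam) i) \/ @cvec (repr Gam) i = y)
     /\ #|[set i | @cvec (repr Gam) i == y]| = 1%N].

(* Formal sums of elements of SS are represented by their coefficients.        *)
Definition act_left (Gam : SS) (y : vec) : SS -> int := fun D =>
  let G := repr Gam in
  \sum_(X : {set 'I_(cnum G)} | `[< SS_Ay y (glue_y X y) >] && (glue_y X y == D))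
     n_left X y
  + \sum_(X : {set 'I_(cnum G)} |
       (y + vsum X == (-1, 0) :> vec) && (glue_y' X y == D)) n_left X y.

Definition act_right (y : vec) (Gam : SS) : SS -> int := fun D =>
  let G := repr Gam in
  \sum_(X : {set 'I_(cnum G)} | `[< SS_Ay y (glue_y X y) >] && (glue_y X y == D))
     n_right y X
  + \sum_(X : {set 'I_(cnum G)} |
       (y + vsum X == (0, -1) :> vec) && (glue_y' X y == D)) n_right y X.

(* Only finitely many terms of each of these two sums are nonzero, so that the *)
(* finitely supported sum over SS_A never takes its default value.             *)
Definition eF_left (R : realType) (N : SS -> R) (y : vec) : SS -> R := fun D =>
  \sum_(Gam \in SS_A)
     N Gam / #|Aut_coll (repr Gam)|%:R * (act_left Gam y D)%:~R.

Definition eF_right (R : realType) (y : vec) (N : SS -> R) : SS -> R := fun D =>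
  \sum_(Gam \in SS_A)
     N Gam / #|Aut_coll (repr Gam)|%:R * (act_right y Gam D)%:~R.

(* N is only ever evaluated on SS_A.                                           *)
Record eF_relations (R : realType) (N : SS -> R) : Prop := {
  eF_empty : N (iso_class empty_coll) = 1;
  eF_vanish : forall Gam : SS, SS_A Gam ->
    (2 * #|components (repr Gam)|)%N%:Z < chi (repr Gam) -> N Gam = 0;
  eF_comm : forall a b : int, 0 < a -> b < a ->
    forall D : SS, SS_Ay (- a, - b) D ->
      eF_left N (- a, - b) D = eF_right (- a, - b) N D }.

(* Main.v *)
Require Import Defs.
From mathcomp Require Import all_boot all_order all_algebra.
From mathcomp Require Import boolp classical_sets reals.
From mathcomp Require Import all_fingroup generic_quotient zify cardinality fsbigop.
Set Implicit Arguments.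
Unset Strict Implicit.
Unset Printing Implicit Defensive.
Import Order.TTheory GRing.Theory Num.Theory.
Local Open Scope quotient_scope.
Local Open Scope ring_scope.

(** The idea: each relation (iii), read off at one well-chosen element D, is a
    linear equation in which one coefficient of e^F appears together only with
    coefficients that come earlier in a well-founded order.

    Let [total] be the sum of all vectors of a collection.  If D is a term of the
    action of y on Gam2, then total D is total Gam2 + 2y, except that it is
    total Gam2 + 2y - e for the terms with y + vsum X = e, where e is (-1, 0) on
    the left and (0, -1) on the right.  So D and y leave only three possible
    values for total Gam2.

    To isolate the coefficient of Gam, choose in Gam a vector w = (a, b) with
    b + 1 < a, put y = (0, -1) - w, which is an admissible index for (iii), and
    let D be Gam with w replaced by y.  Then Gam contributes to the right-hand
    side at D, through X = {w}, with the positive weight y /\ w = a.  Any other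
    Gam2 contributing to either side has
    - total Gam2 = total Gam + (-1, 1), from y + vsum X = (-1, 0); or
    - total Gam2 = total Gam + (0, 1), from y + vsum X in A; or
    - total Gam2 = total Gam and more vectors than Gam, from
      y + vsum X = (0, -1) with X of at least two elements; a single vector X is
      necessarily w, and then Gam2 is Gam ([glues_right_precedes]).
    The order [precedes] is the lexicographic order making all three cases
    smaller than Gam.

    It is well founded ([precedes_ind]) thanks to (ii): for a collection in A, the
    number of vectors is at most the first coordinate of the total, and where the
    coefficient is not forced to vanish the second coordinate of the total is at
    most minus half of the first.  The same estimate shows that a nonempty
    non-vanishing Gam does contain a vector w as above ([exists_pivot]).  Finally,
    the right-hand side at D is a genuine finite sum, because there are finitely
    many collections in A with given first coordinate of the total and second
    coordinate bounded below ([total_bounded_finite]); hence the term of Gam can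
    be split off and cancelled.  The empty collection is the base case, by (i). *)

(** * Isomorphism invariants of collections *)

Definition total (G : coll) : vec := \sum_i @cvec G i.

Definition vecs_inA (G : coll) : Prop := forall i, inA (@cvec G i).

Lemma coll_iso_sym G H : coll_iso G H -> coll_iso H G.
Proof.
move=> /asboolP GH; apply/asboolP.
by rewrite -[asbool _]/(coll_isob H G) coll_isob_sym.
Qed.

Lemma coll_iso_trans G H K : coll_iso G H -> coll_iso H K -> coll_iso G K.
Proof.
by move=> /asboolP GH /asboolP HK; apply/asboolP; exact: coll_isob_trans GH HK.
Qed.

Lemma iso_class_repr (Gam : SS) : iso_class (repr Gam) = Gam.
Proof. exact: reprK. Qed.

Lemma repr_iso_class (G : coll) : coll_iso (repr (iso_class G)) G.
Proof. exact/iso_classP/iso_class_repr. Qed.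

Lemma cnum_iso G H : coll_iso G H -> cnum G = cnum H.
Proof. by move=> [f [/bij_eq_card]]; rewrite !card_ord. Qed.

Lemma total_iso G H : coll_iso G H -> total G = total H.
Proof.
move=> [f [bf fv _]]; rewrite /total [RHS](reindex f) /=; last exact: onW_bij.
by apply: eq_bigr => i _; rewrite fv.
Qed.

(** Isomorphisms onto a collection indexed by an arbitrary finite type can be given
    without mentioning the enumeration of that type. *)
Lemma coll_on_iso (G : coll) (T : finType) (v : T -> vec) (e : rel T)
    (eP : [/\ reflexive e, symmetric e & transitive e])
    (h : 'I_(cnum G) -> T) :
    bijective h -> (forall i, v (h i) = cvec i) ->
    (forall i j, e (h i) (h j) = cconn i j) ->
  coll_iso G (coll_on v eP).
Proof.
move=> bh hv he; exists (enum_rank \o h : 'I_(cnum G) -> 'I_(cnum (coll_on v eP))).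
split; first by apply: bij_comp bh; exact: enum_rank_bij.
  by move=> i; rewrite /= enum_rankK hv.
by move=> i j; rewrite /= !enum_rankK he.
Qed.

Lemma fst_sum I (s : seq I) (P : pred I) (F : I -> vec) :
  (\sum_(i <- s | P i) F i).1 = \sum_(i <- s | P i) (F i).1.
Proof. exact: (big_morph fst). Qed.

Lemma snd_sum I (s : seq I) (P : pred I) (F : I -> vec) :
  (\sum_(i <- s | P i) F i).2 = \sum_(i <- s | P i) (F i).2.
Proof. exact: (big_morph snd). Qed.

(** * Gluing *)

Lemma total_glue (G : coll) (X : {set 'I_(cnum G)}) (u : seq vec) :
  total (glue X u) + vsum X = \sum_(v <- u) v + total G.
Proof.
have -> : total (glue X u) = \sum_p @glue_vec G X u p.
  by rewrite [RHS](reindex _ (onW_bij _ (@enum_val_bij _))).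
rewrite big_sumType /= (big_nth 0) big_mkord -addrA; congr (_ + _).
rewrite -(big_sub (fun i => i \notin X) (fun i => cvec i)) /=.
by rewrite /total [RHS](bigID (fun i => i \in X)) [RHS]addrC.
Qed.

Lemma cnum_glue (G : coll) (X : {set 'I_(cnum G)}) (u : seq vec) :
  (cnum (glue X u) + #|X| = size u + cnum G)%N.
Proof.
rewrite /= card_sum card_ord card_sig -addnA; congr (_ + _)%N.
by rewrite addnC -[RHS](card_ord (cnum G)) -(cardC X).
Qed.

Definition replace_vec (G : coll) (i : 'I_(cnum G)) (y : vec) : coll :=
  Coll (fun k => if k == i then y else cvec k) (cconnP G).

(** Removing a single vector and gluing in y puts y in the component of the removed
    vector: this changes one vector and nothing else, and can be undone. *)
Lemma glue1_iso (G : coll) (i : 'I_(cnum G)) (y : vec) :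
  coll_iso (replace_vec i y) (glue [set i] [:: y]).
Proof.
have [er es et] := cconnP G.
(* [h] sends i to the new vector y and every other index to itself. *)
pose h (k : 'I_(cnum G)) : glue_pt [set i] [:: y] := oapp inr (inl ord0) (insub k).
have hi : h i = inl ord0 by rewrite /h insubF // inE eqxx.
have hN k (kX : k \notin [set i]) : h k = inr (Sub k kX) by rewrite /h insubT.
have nX (k : 'I_(cnum G)) : k != i -> k \notin [set i] by rewrite inE.
have m1 (k : 'I_(cnum G)) : Defs.meets [set i] k = cconn k i.
  apply/existsP/idP => [[j /andP[/finset.set1P -> //]]|ki].
  by exists i; rewrite inE eqxx.
apply: (@coll_on_iso (replace_vec i y) _ _ _ _ h).
- exists (fun p : glue_pt [set i] [:: y] =>
            match p with inl _ => i | inr k => val k end).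
    by move=> k; case: (eqVneq k i) => [->|/nX kX]; rewrite ?hi ?(hN _ kX).
  by case=> [k|[k kX]] /=; rewrite ?hi ?(hN _ kX) // [k]ord1.
- by move=> k /=; case: (eqVneq k i) => [->|/nX kX]; rewrite ?hi ?(hN _ kX).
move=> k l /=.
case: (eqVneq k i) => [->|/nX kX]; case: (eqVneq l i) => [->|/nX lX];
  rewrite ?hi ?(hN _ kX) ?(hN _ lX) /glue_conn /= ?m1 ?er ?orbF ?andbT //.
apply/orP/idP => [[/andP[ki li]|//]|]; last by right.
by apply: et ki _; rewrite es.
Qed.

(** As y lies outside A, an isomorphism has to match the two replaced vectors, so
    the same map is an isomorphism of the original collections. *)
Lemma replace_vec_inj (G H : coll) (i : 'I_(cnum G)) (j : 'I_(cnum H)) (y : vec) :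
    vecs_inA G -> vecs_inA H -> ~~ inA y -> cvec i = cvec j ->
  coll_iso (replace_vec i y) (replace_vec j y) -> coll_iso G H.
Proof.
move=> GA HA yA ij [f [bf /= fv fc]]; exists f; split=> // k.
have := fv k; case: eqP => fk; case: eqP => ki //.
- by rewrite fk ki ij.
- by move=> yk; move: (GA k); rewrite -yk (negPf yA).
- by move=> ky; move: (HA (f k)); rewrite ky (negPf yA).
Qed.

(** The relation indexed by y may be evaluated at the element D used to isolate the
    coefficient of Gam. *)
Lemma SS_Ay_glue1 (G : coll) (i : 'I_(cnum G)) (y : vec) :
  vecs_inA G -> ~~ inA y -> SS_Ay y (glue_y' [set i] y).
Proof.
move=> GA yA; rewrite /SS_Ay /=.
have := coll_iso_trans (repr_iso_class _) (coll_iso_sym (glue1_iso i y)).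
rewrite -/(glue_y' _ _); set D := repr _ => -[f [bf /= fv _]].
split=> [k|]; first by rewrite -fv; case: eqP => _; [right|left; exact: GA].
have [g fK gK] := bf; apply/eqP/cards1P; exists (g i); apply/setP => k.
rewrite !inE -fv -(can_eq fK (k)) gK; case: (f k =P i) => _; first exact: eqxx.
by apply: contraNF yA => /eqP <-; exact: GA.
Qed.

(** * The terms of the relation *)

(** The combinatorial condition for D to occur in an action of y on Gam, with
    weights forgotten; e is the exceptional value of y + vsum X, namely (-1, 0) on
    the left and (0, -1) on the right. *)
Definition glues (Gam : SS) (y e : vec) (D : SS) : Prop :=
  exists X : {set 'I_(cnum (repr Gam))},
    glue_y X y = D \/ y + vsum X = e /\ glue_y' X y = D.

Lemma act_left_glues Gam y D : act_left Gam y D != 0 -> glues Gam y (-1, 0) D.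
Proof.
move=> H; apply: contrapT => ng; move: H.
rewrite /act_left !big1 ?addr0 ?eqxx // => X /andP[].
  by move=> /eqP yX /eqP XD; case: ng; exists X; right.
by move=> _ /eqP XD; case: ng; exists X; left.
Qed.

Lemma act_right_glues Gam y D : act_right y Gam D != 0 -> glues Gam y (0, -1) D.
Proof.
move=> H; apply: contrapT => ng; move: H.
rewrite /act_right !big1 ?addr0 ?eqxx // => X /andP[].
  by move=> /eqP yX /eqP XD; case: ng; exists X; right.
by move=> _ /eqP XD; case: ng; exists X; left.
Qed.

Lemma n_right_ge0 (G : coll) y (X : {set 'I_(cnum G)}) : 0 <= n_right y X.
Proof. by apply: prodr_ge0 => i _; rewrite le_max lexx. Qed.

Lemma n_right_set1 (G : coll) y (i : 'I_(cnum G)) :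
  n_right y [set i] = Num.max 0 (wedge y (cvec i)).
Proof.
rewrite /n_right.
have -> : ordered_vecs [set i] = [:: cvec i].
  apply: perm_small_eq => //.
  by have := ordered_vecs_perm [set i]; rewrite /image_mem enum_set1.
by rewrite /= big_nat1 big_geq // addr0.
Qed.

(** Weights are products of nonnegative factors, so no cancellation can occur and
    the single term X = {i} suffices. *)
Lemma act_right_gt0 (Gam : SS) (i : 'I_(cnum (repr Gam))) (y : vec) :
    y + cvec i = (0, -1) -> 0 < wedge y (cvec i) ->
  0 < act_right y Gam (glue_y' [set i] y).
Proof.
move=> yi wi; apply: ltr_wpDl.
  by apply: sumr_ge0 => X _; exact: n_right_ge0.
rewrite (bigD1 [set i]) /=; last by rewrite eqxx /vsum big_set1 yi eqxx.
apply: ltr_wpDr; first by apply: sumr_ge0 => X _; exact: n_right_ge0.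
by rewrite n_right_set1 lt_max wi orbT.
Qed.

(** The second coordinate of the total and the number of vectors are compared in
    reverse because they are larger in the collections that compete with Gam; for a
    given first coordinate, both are bounded above on the collections in A whose
    coefficient (ii) does not force to be zero. *)
Definition precedes (G H : coll) : Prop :=
  (total G).1 < (total H).1 \/
  (total G).1 = (total H).1 /\
    ((total H).2 < (total G).2 \/
     (total G).2 = (total H).2 /\ (cnum H < cnum G)%N).

(** Gluing deletes vsum X and inserts y and y + vsum X, so the total does not depend
    on X. *)
Lemma total_glue_y (Gam D : SS) (X : {set 'I_(cnum (repr Gam))}) y :
  glue_y X y = D -> total (repr D) = total (repr Gam) + y + y.
Proof.
move=> <-; rewrite (total_iso (repr_iso_class _)).
apply: (addIr (vsum X)); rewrite total_glue !big_cons big_nil addr0.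
by rewrite addrC -!addrA; congr (_ + _); rewrite [RHS]addrCA.
Qed.

Lemma total_glue_y' (Gam D : SS) (X : {set 'I_(cnum (repr Gam))}) y e :
  y + vsum X = e -> glue_y' X y = D -> total (repr D) + e = total (repr Gam) + y + y.
Proof.
move=> <- <-; rewrite (total_iso (repr_iso_class _)).
rewrite addrCA total_glue big_cons big_nil addr0.
by rewrite addrA addrC addrA.
Qed.

Lemma cnum_glue_y' (Gam D : SS) (X : {set 'I_(cnum (repr Gam))}) y :
  glue_y' X y = D -> (cnum (repr D) + #|X| = (cnum (repr Gam)).+1)%N.
Proof.
by move=> <-; rewrite (cnum_iso (repr_iso_class _)) cnum_glue.
Qed.

Section Pivot.
Variables (Gam : SS) (i : 'I_(cnum (repr Gam))) (y : vec).
Hypothesis yi : y + cvec i = (0, -1).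
Let D := glue_y' [set i] y.

Let totalD : total (repr D) + (0, -1) = total (repr Gam) + y + y.
Proof. by apply: total_glue_y' (erefl _); rewrite /vsum big_set1. Qed.

Let cnumD : cnum (repr D) = cnum (repr Gam).
Proof. by have := cnum_glue_y' (erefl D); rewrite cards1 addn1 => -[]. Qed.

(** On the left no occurrence of Gam itself is possible: its total would have to be
    shifted by (0, 1) or (-1, 1). *)
Lemma glues_left_precedes Gam2 :
  glues Gam2 y (-1, 0) D -> precedes (repr Gam2) (repr Gam).
Proof.
move: totalD => /[dup] /(congr1 fst) /= e1 /(congr1 snd) /= e2.
case=> X [/total_glue_y|[yX /(total_glue_y' yX)]].
  move=> /[dup] /(congr1 fst) /= f1 /(congr1 snd) /= f2.
  by right; split; [|left]; lia.
by move=> /(congr1 fst) /= f1; left; lia.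
Qed.

(** The value of total Gam2 is total Gam + (0, 1) or total Gam.  In the second case
    Gam2 has #|X| - 1 more vectors than Gam: it precedes Gam if X has at least two
    elements; X is not empty since y is not (0, -1); and a single vector in X must
    equal cvec i, so that undoing the replacement by y gives Gam back.  The
    information on totals in the conclusion is what makes the right-hand side a
    finite sum. *)
Lemma glues_right_precedes Gam2 :
    SS_A Gam -> SS_A Gam2 -> y.1 < 0 -> glues Gam2 y (0, -1) D ->
  Gam2 = Gam \/
  [/\ precedes (repr Gam2) (repr Gam),
      (total (repr Gam2)).1 = (total (repr Gam)).1 &
      (total (repr Gam)).2 <= (total (repr Gam2)).2].
Proof.
move=> GA G2A y0.
move: totalD => /[dup] /(congr1 fst) /= e1 /(congr1 snd) /= e2.
case=> X [/total_glue_y|[yX XD]].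
  move=> /[dup] /(congr1 fst) /= f1 /(congr1 snd) /= f2.
  by right; split; [right; split; [|left]| |]; lia.
move: (total_glue_y' yX XD) => /[dup] /(congr1 fst) /= f1 /(congr1 snd) /= f2.
have := cnum_glue_y' XD; rewrite cnumD.
have [X1|X1] := ltnP 1 #|X|.
  by move=> c; right; split; [right; split; [|right]| |]; lia.
case: (posnP #|X|) => [X0 _|X0 _].
  move: yX; rewrite (cards0_eq X0) /vsum big_set0 => /(congr1 fst) /= yE.
  by move: y0; rewrite -[y.1]addr0 yE ltxx.
left; have /cards1P[j Xj]: #|X| == 1%N by rewrite eqn_leq X1.
rewrite -(iso_class_repr Gam) -(iso_class_repr Gam2); apply/iso_classP.
apply: (@replace_vec_inj _ _ j i y G2A GA).
- by rewrite /inA /=; lia.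
- by apply: (addrI y); rewrite yi -yX Xj /vsum big_set1.
apply: coll_iso_trans (glue1_iso _ _) _.
apply: coll_iso_trans (coll_iso_sym (glue1_iso _ _)).
by apply/iso_classP; rewrite -[LHS]/(glue_y' _ _) -Xj XD.
Qed.
End Pivot.

(** * Finiteness and well-foundedness *)

Lemma cnum_le_total (G : coll) : vecs_inA G -> (cnum G)%:Z <= (total G).1.
Proof.
move=> GA; rewrite /total fst_sum.
apply: le_trans (_ : \sum_(i < cnum G) 1 <= _).
  by rewrite sumr_const card_ord natz.
by apply: ler_sum => i _; have := GA i; rewrite /inA /=; lia.
Qed.

(** There are finitely many vectors to choose from and finitely many equivalence
    relations.  In the coordinates (a, a - b) the set A is contained in the first
    quadrant, so natural numbers suffice. *)
Lemma bounded_finite (K : nat) : finite_set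
  [set Gam : SS | (cnum (repr Gam) <= K)%N /\
    forall i, 0 <= (@cvec (repr Gam) i).1 <= K%:Z /\
      0 <= (@cvec (repr Gam) i).1 - (@cvec (repr Gam) i).2 <= K%:Z].
Proof.
(* An equivalence relation is encoded by labelling each index with its class, and
   any labelling gives an equivalence relation. *)
have lab n (e : {ffun 'I_n -> {set 'I_n}}) :
    let c i j := e i == e j in [/\ reflexive c, symmetric c & transitive c].
  split=> [i|i j|j i k] /=; [exact: eqxx|exact: eq_sym|].
  by move=> /eqP -> /eqP ->.
pose F n (p : {ffun 'I_n -> 'I_K.+1 * 'I_K.+1} * {ffun 'I_n -> {set 'I_n}}) : SS :=
  iso_class (@Coll n (fun i => ((p.1 i).1%:Z, (p.1 i).1%:Z - (p.1 i).2%:Z))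
                   _ (lab n p.2)).
apply: (@sub_finite_set _ _ (\bigcup_(n in `I_K.+1) range (F n))); last first.
  apply: bigcup_finite => [|n _]; first exact: finite_II.
  by apply: finite_image; exact: finite_finset.
move=> Gam [cK vK]; exists (cnum (repr Gam)) => //=; set G := repr Gam.
have [er es et] := cconnP G.
exists ([ffun i => (inord `|(@cvec G i).1|%N,
                    inord `|(@cvec G i).1 - (@cvec G i).2|%N)],
        [ffun i => [set j | @cconn G i j]]) => //.
rewrite -[RHS]iso_class_repr; apply/iso_classP; exists id; split=> //=.
- by exists id.
- move=> i; have [] := vK i; rewrite -/G ffunE /= => b1 b2.
  by rewrite !inordK; [case: (cvec i) b1 b2 => a b /= *; congr pair; lia| lia..].
move=> i j; rewrite !ffunE; apply/idP/eqP => [ij|/setP /(_ j)].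
  apply/setP => k; rewrite !inE; apply/idP/idP; apply: et => //.
  by rewrite es.
by rewrite !inE er.
Qed.

(** Each of a and a - b is nonnegative on A, hence bounded by its sum over the
    collection. *)
Lemma total_bounded_finite (s t : int) : finite_set
  [set Gam : SS | [/\ SS_A Gam, (total (repr Gam)).1 = s &
                     t <= (total (repr Gam)).2]].
Proof.
apply: sub_finite_set (bounded_finite (`|s| + `|s - t|)%N) => Gam [] /= GA.
set G := repr Gam => s1 t2.
have cG := cnum_le_total GA; split=> [|i]; first by rewrite -/G in cG *; lia.
rewrite -/G in cG *.
have iA k : 0 < (@cvec G k).1 /\ (@cvec G k).2 <= (@cvec G k).1.
  by have := GA k; rewrite /inA /= => /andP.
have a_le : (@cvec G i).1 <= s.
  rewrite -s1 /total fst_sum (bigD1 i) //= lerDl.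
  by apply: sumr_ge0 => k _; have := iA k; lia.
have d_le : (@cvec G i).1 - (@cvec G i).2 <= s - t.
  apply: le_trans (_ : (total G).1 - (total G).2 <= _); last by lia.
  rewrite /total fst_sum snd_sum -sumrB (bigD1 i) //= lerDl.
  by apply: sumr_ge0 => k _; have := iA k; lia.
by have := iA i; lia.
Qed.

(** The hypothesis of condition (ii). *)
Definition vanishing (G : coll) : bool := (2 * #|components G|)%N%:Z < chi G.

Lemma chi_total (G : coll) :
  chi G = (cnum G)%:Z + 2 * (total G).1 + 2 * (total G).2.
Proof.
rewrite /chi !big_split /= sumr_const card_ord -!mulr_sumr.
by rewrite -[(cnum G)%:Z]natz /total fst_sum snd_sum.
Qed.

(** With n vectors and total (s, t), non-vanishing gives n + 2 s + 2 t <= 2 n, as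
    there are at most n components; conclude with n <= s. *)
Lemma non_vanishing_total (G : coll) :
  vecs_inA G -> ~~ vanishing G -> (total G).1 + 2 * (total G).2 <= 0.
Proof.
move=> /cnum_le_total; rewrite /vanishing chi_total.
have : (#|components G| <= cnum G)%N.
  by rewrite -[leqRHS]card_ord -cardsT; exact: leq_imset_card.
lia.
Qed.

(** Among non-vanishing collections, [precedes] never descends forever: the first
    coordinate s of the total is nonnegative; for s fixed, the second coordinate
    is at most 0; and the number of vectors is at most s. *)
Lemma precedes_ind (P : SS -> Prop) :
  (forall Gam, SS_A Gam -> ~~ vanishing (repr Gam) ->
     (forall Gam2, SS_A Gam2 -> ~~ vanishing (repr Gam2) ->
        precedes (repr Gam2) (repr Gam) -> P Gam2) -> P Gam) ->
  forall Gam, SS_A Gam -> ~~ vanishing (repr Gam) -> P Gam.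
Proof.
move=> step Gam.
move Ea: `|(total (repr Gam)).1|%N => a; elim/ltn_ind: a Gam Ea => a IHa Gam Ea.
move Eb: `|(total (repr Gam)).2|%N => b.
elim/ltn_ind: b Gam Ea Eb => b IHb Gam Ea Eb.
move Ec: (a - cnum (repr Gam))%N => c.
elim/ltn_ind: c Gam Ea Eb Ec => c IHc Gam Ea Eb Ec GA nG.
apply: step => // Gam2 G2A nG2.
have := (cnum_le_total GA, non_vanishing_total GA nG).
have := (cnum_le_total G2A, non_vanishing_total G2A nG2).
move=> [c2 b2] [c1 b1] [lt|[ea [lt|[eb lt]]]].
- by apply: IHa (erefl _) _ _ => //; lia.
- by apply: IHb (erefl _) _ _ => //; lia.
- by apply: IHc (erefl _) _ _ => //; lia.
Qed.

(** * Determination of one coefficient *)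

(** Otherwise b >= a - 1 for all vectors, so the total (s, t) has t >= s - n >= 0
    with n > 0 the number of vectors, against s + 2 t <= 0 and s >= n. *)
Lemma exists_pivot (G : coll) :
    vecs_inA G -> ~~ vanishing G -> (0 < cnum G)%N ->
  exists i, (@cvec G i).2 + 1 < (@cvec G i).1.
Proof.
move=> GA nG G0; apply: contrapT => ne.
have := (cnum_le_total GA, non_vanishing_total GA nG) => -[].
suff : (total G).1 - (cnum G)%:Z <= (total G).2 by lia.
rewrite /total fst_sum snd_sum -[X in _ - X%:Z]card_ord -natz -sumr_const -sumrB.
apply: ler_sum => i _; rewrite leNgt; apply/negP => lt.
by apply: ne; exists i; lia.
Qed.

Lemma cnum0_empty (Gam : SS) : cnum (repr Gam) = 0%N -> Gam = iso_class empty_coll.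
Proof.
move=> G0; rewrite -(iso_class_repr Gam); apply/iso_classP.
have f0 : 'I_(cnum (repr Gam)) -> 'I_0 by rewrite G0.
have g0 : 'I_0 -> 'I_(cnum (repr Gam)) by case.
exists f0; split; [exists g0|..]; move=> i; try by case: (f0 i).
by case: i.
Qed.

Lemma Aut_coll_gt0 (G : coll) : (0 < #|Aut_coll G|)%N.
Proof.
apply/card_gt0P; exists 1%g; rewrite inE.
by apply/andP; split; do ?apply/forallP => ?; rewrite !perm1.
Qed.

Theorem lemma2p5 (R : realType) (N N' : SS -> R)
    (hN : eF_relations N) (hN' : eF_relations N') (Gam : SS) (hGam : SS_A Gam) :
  N Gam = N' Gam.
Proof.
(* By (ii), the induction may be restricted to non-vanishing collections. *)
have van Gam2 : SS_A Gam2 -> vanishing (repr Gam2) -> N Gam2 = N' Gam2.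
  by move=> A2 v2; rewrite (eF_vanish hN) // (eF_vanish hN').
case: (boolP (vanishing (repr Gam))) => [|]; first exact: van.
move: Gam hGam; apply: precedes_ind => Gam GA nG IH0.
have IH Gam2 : SS_A Gam2 -> precedes (repr Gam2) (repr Gam) -> N Gam2 = N' Gam2.
  move=> A2 p2; case: (boolP (vanishing (repr Gam2))) => [|n2]; first exact: van.
  exact: IH0.
case: (posnP (cnum (repr Gam))) => [/cnum0_empty ->|G0].
  by rewrite (eF_empty hN) (eF_empty hN').
have [i lti] := exists_pivot GA nG G0.
have := GA i; rewrite /inA /= => /andP[a0 ba].
set w := cvec i in lti a0 ba.
pose y : vec := (- w.1, - (w.2 + 1)).
have yi : y + w = (0, -1) by rewrite [LHS]surjective_pairing /=; congr pair; lia.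
have y0 : y.1 < 0 by rewrite /=; lia.
have yw : 0 < wedge y w by rewrite /wedge /=; nia.
pose D := glue_y' [set i] y.
have DA : SS_Ay y D by apply: SS_Ay_glue1 => //; rewrite /inA /=; lia.
have cN := eF_comm hN a0 lti DA.
have cN' := eF_comm hN' a0 lti DA.
have left_eq : eF_left N y D = eF_left N' y D.
  apply: eq_fsbigr => Gam2 /set_mem A2.
  have [->|/act_left_glues g2] := eqVneq (act_left Gam2 y D) 0.
    by rewrite !mulr0.
  by rewrite (IH _ A2) //; exact: glues_left_precedes g2.
have right_eq : eF_right y N D = eF_right y N' D.
  by rewrite -[LHS]cN -[RHS]cN'.
(* Both right-hand sides are supported on the finite set B. *)
pose B := [set Gam2 : SS | [/\ SS_A Gam2,
  (total (repr Gam2)).1 = (total (repr Gam)).1 &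
  (total (repr Gam)).2 <= (total (repr Gam2)).2]]%classic.
have outB M Gam2 : SS_A Gam2 -> ~ B Gam2 ->
    M / #|Aut_coll (repr Gam2)|%:R * (act_right y Gam2 D)%:~R = 0 :> R.
  move=> A2 nB; have [->|/act_right_glues g2] := eqVneq (act_right y Gam2 D) 0.
    by rewrite mulr0.
  case: nB; have [->|[_ e1 e2]] := glues_right_precedes yi GA A2 y0 g2.
    by split.
  by split.
have BGam : B Gam by split.
have split_right (M : SS -> R) : eF_right y M D =
    M Gam / #|Aut_coll (repr Gam)|%:R * (act_right y Gam D)%:~R +
    \sum_(Gam2 \in (B `\ Gam)%classic)
       M Gam2 / #|Aut_coll (repr Gam2)|%:R * (act_right y Gam2 D)%:~R.
  rewrite -[RHS](fsbigD1 Gam B) //; last exact: total_bounded_finite.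
  by apply/esym/fsbig_widen => [Gam2 []//|Gam2 [A2 nB]]; exact: outB.
move: right_eq; rewrite !split_right.
have -> : \sum_(Gam2 \in (B `\ Gam)%classic)
       N Gam2 / #|Aut_coll (repr Gam2)|%:R * (act_right y Gam2 D)%:~R =
    \sum_(Gam2 \in (B `\ Gam)%classic)
       N' Gam2 / #|Aut_coll (repr Gam2)|%:R * (act_right y Gam2 D)%:~R.
  apply: eq_fsbigr => Gam2 /set_mem [[A2 _ _] ne].
  have [->|/act_right_glues g2] := eqVneq (act_right y Gam2 D) 0.
    by rewrite !mulr0.
  rewrite (IH _ A2) //.
  by have [/ne|[]] := glues_right_precedes yi GA A2 y0 g2.
have act_neq0 : (act_right y Gam D)%:~R != 0 :> R.
  by rewrite intr_eq0 gt_eqF // act_right_gt0.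
have aut_neq0 : #|Aut_coll (repr Gam)|%:R^-1 != 0 :> R.
  by rewrite invr_eq0 pnatr_eq0 -lt0n Aut_coll_gt0.
by move=> /addIr /(mulIf act_neq0) /(mulIf aut_neq0).
Qed.
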